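(* Let $\mathcal{A}$ be a unital $C^*$-algebra, $a\in \mathcal{A}$ and $f\in S(\mathcal{A})$. Then for all $t\in[0,1]$ and $r\in\mathbb{N}$, $$|f(a)|^{2r} \leq f\big(t|a|^{2r}+ (1-t) |a^*|^{2r}\big).$$ Moreover, for all $t\in[0,1]$ and $r\in\mathbb{N}$, $$v^{2r}(a) \leq \left\| t|a|^{2r}+(1-t)|a^*|^{2r} \right\|.$$ In particular, for $r=1$, $$v^2(a) \leq \left\| ta^*a+(1-t)aa^* \right\| .$$
   Context: $\mathcal{A}$ is a unital $C^*$-algebra with unit $e$. $S(\mathcal{A})$ is the set of normalized states, i.e. continuous linear functionals $f$ on $\mathcal{A}$ with $f(e)=\|f\|=1$ (equivalently, positive linear functionals with $f(e)=1$). The algebraic numerical radius of $a$ is $v(a)=\sup\{|f(a)|: f\in S(\mathcal{A})\}$, and $v^s(a)$ means $(v(a))^s$. $|a|=(a^*a)^{1/2}$, so $|a^*|=(aa^* )^{1/2}$. $\mathbb{N}=\{1,2,\ldots\}$. *)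

(* Defs.v *)
From HB Require Import structures.
From mathcomp Require Import all_boot all_order all_algebra.
From mathcomp Require Import complex.
From mathcomp Require Import all_classical all_reals all_analysis.

Set Implicit Arguments.
Unset Strict Implicit.
Unset Printing Implicit Defensive.

Import Order.TTheory GRing.Theory Num.Theory.
Import numFieldNormedType.Exports.

Local Open Scope classical_set_scope.
Local Open Scope ring_scope.
Local Open Scope complex_scope.

(* C*-algebras over the complex field R[i] are built in two steps, algebra
   first and completeness second. The library has no structure that is both a
   ring and a normed module, and Hierarchy Builder refuses to add one on top of
   the existing hierarchy. So the norm is a real-valued operation cnorm of a
   complex algType, and the normed-module structure it induces is carried by
   the alias normed_space A of A. *)
HB.mixin Record Algebra_isPreCStar (R : realType) A of GRing.Algebra R[i] A := {
  cnorm : A -> R ;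
  cnormD : forall x y : A, cnorm (x + y) <= cnorm x + cnorm y ;
  cnormZ : forall (k : R[i]) (x : A), cnorm (k *: x) = complex.Re `|k| * cnorm x ;
  cnorm0_eq0 : forall x : A, cnorm x = 0 -> x = 0 ;
  cnormM : forall x y : A, cnorm (x * y) <= cnorm x * cnorm y ;
  star : A -> A ;
  starD : forall x y : A, star (x + y) = star x + star y ;
  starZ : forall (k : R[i]) (x : A), star (k *: x) = Num.conj k *: star x ;
  starM : forall x y : A, star (x * y) = star y * star x ;
  starK : forall x : A, star (star x) = x ;
  cnorm_star : forall x : A, cnorm (star x * x) = cnorm x ^+ 2
}.

#[short(type="preCStarAlgType")]
HB.structure Definition PreCStarAlgebra (R : realType) :=
  {A of GRing.Algebra R[i] A & Algebra_isPreCStar R A}.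

Definition normed_space (R : realType) (A : Type) : Type := A.

Section NormedSpace.
Variables (R : realType) (A : preCStarAlgType R).

HB.instance Definition _ :=
  GRing.Lmodule.copy (normed_space R A) (A : lmodType R[i]).

Let nrm (x : normed_space R A) : R[i] := (cnorm (x : A))%:C.

Let nrmD (x y : normed_space R A) : nrm (x + y) <= nrm x + nrm y.
Proof. by rewrite /nrm -rmorphD lecR; exact: cnormD. Qed.

Let nrmZ (k : R[i]) (x : normed_space R A) : nrm (k *: x) = `|k| * nrm x.
Proof.
by rewrite -[in RHS](RRe_real (ger0_real (normr_ge0 k))) -rmorphM /nrm cnormZ.
Qed.

Let nrm0_eq0 (x : normed_space R A) : nrm x = 0 -> x = 0.
Proof. by move=> /complexI; exact: cnorm0_eq0. Qed.

HB.instance Definition _ :=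
  Lmodule_isNormed.Build R[i] (normed_space R A) nrmD nrmZ nrm0_eq0.

Lemma normed_spaceE (x : A) : `|x : normed_space R A| = (cnorm x)%:C.
Proof. by []. Qed.

End NormedSpace.

HB.mixin Record PreCStar_isComplete (R : realType) A of PreCStarAlgebra R A := {
  cnorm_complete : forall F : set_system (normed_space R A),
    ProperFilter F -> cauchy F -> cvg F
}.

#[short(type="cstarAlgType")]
HB.structure Definition CStarAlgebra (R : realType) :=
  {A of PreCStarAlgebra R A & PreCStar_isComplete R A}.

HB.instance Definition _ (R : realType) (A : cstarAlgType R) :=
  Uniform_isComplete.Build (normed_space R A) (@cnorm_complete R A).

Section CStarAlgebraDefs.
Variables (R : realType) (A : cstarAlgType R).

Definition selfadjoint (x : A) : Prop := star x = x.

Definition invertible (x : A) : Prop := exists y : A, x * y = 1 /\ y * x = 1.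

Definition spectrum (x : A) : set R[i] :=
  [set l : R[i] | ~ invertible (x - l *: 1)].

(* In the order of R[i], 0 <= l means that l is real and nonnegative. *)
Definition positive (x : A) : Prop :=
  selfadjoint x /\ forall l : R[i], spectrum x l -> 0 <= l.

(* For positive x there is exactly one such b; otherwise the value is
   irrelevant. *)
Definition sqrtA (x : A) : A := xget 0 [set b : A | positive b /\ b ^+ 2 = x].

Definition absA (a : A) : A := sqrtA (star a * a).

Definition opnorm (f : {linear A -> (R[i])^o}) : \bar R :=
  ereal_sup [set (complex.Re `|f x|)%:E | x in [set x : A | cnorm x <= 1]].

Definition states : set {linear A -> (R[i])^o} :=
  [set f : {linear A -> (R[i])^o} |
    [/\ continuous (f : normed_space R A -> (R[i])^o),
        f 1 = 1 & opnorm f = 1%:E]].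

Definition numradius (a : A) : R :=
  sup [set complex.Re `|f a| | f in states].

End CStarAlgebraDefs.

(* Main.v *)
Require Import Defs.
From mathcomp Require Import all_boot all_order all_algebra.
From mathcomp Require Import complex.
From mathcomp Require Import all_classical all_reals all_analysis.
From mathcomp Require Import ring lra.
Import Order.TTheory GRing.Theory Num.Theory.
Import numFieldNormedType.Exports.
Local Open Scope classical_set_scope.
Local Open Scope ring_scope.
Local Open Scope complex_scope.

(* For a state [f], nonnegativity of [f (star x * x)] gives
   [|f a| ^ 2 <= f (star a * a)] (variance) and
   [f b * f (b ^ r) <= f (b ^ r.+1)] for [b = star a * a], hence
   [|f a| ^ 2r <= f (b ^ r)], and likewise for [star a].
   So everything rests on the positivity of [star a * a], which also gives the
   existence of its square root. It is proved without functional calculus: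
   positivity of [h] is expressed as [cnorm (t - h) <= t] for some [t > 0],
   square roots are limits of an iteration, and the final step of the classical
   argument (a [c] with [- star c * c] positive vanishes) compares the bounded
   powers of [1 + star c * c] with those of [1 + c * star c]. *)

(** * Consequences of the C*-identity for the norm and the involution *)

Section PreCStar.
Context {R : realType} {A : preCStarAlgType R}.
Implicit Types (x y z : A) (t : R).

Lemma conjC_real t : Num.conj (t%:C) = t%:C :> R[i].
Proof. exact: conjc_real. Qed.

Lemma cnormZr t x : cnorm (t%:C *: x) = `|t| * cnorm x.
Proof. by rewrite cnormZ normc_def /= expr0n addr0 sqrtr_sqr. Qed.

Lemma cnormN x : cnorm (- x) = cnorm x.
Proof. by rewrite -scaleN1r cnormZ normrN1 mul1r. Qed.

Lemma cnorm0 : cnorm (0 : A) = 0.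
Proof. by rewrite -(scale0r (0 : A)) cnormZr normr0 mul0r. Qed.

Lemma cnorm_ge0 x : 0 <= cnorm x.
Proof.
have := cnormD x (- x); rewrite subrr cnorm0 cnormN -mulr2n.
by rewrite pmulrn_lge0.
Qed.

Lemma cnormB x y : cnorm (x - y) <= cnorm x + cnorm y.
Proof. by rewrite -(cnormN y); exact: cnormD. Qed.

Lemma cnorm_distC x y : cnorm (x - y) = cnorm (y - x).
Proof. by rewrite -cnormN opprB. Qed.

Lemma starZr t x : star (t%:C *: x) = t%:C *: star x.
Proof. by rewrite starZ conjC_real. Qed.

Lemma starN x : star (- x) = - star x.
Proof. by rewrite -scaleN1r starZ rmorphN1 scaleN1r. Qed.

Lemma starB x y : star (x - y) = star x - star y.
Proof. by rewrite starD starN. Qed.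

Lemma star0 : star (0 : A) = 0.
Proof. by rewrite -[X in star X](subrr (0 : A)) starB subrr. Qed.

Lemma star1 : star (1 : A) = 1.
Proof. by rewrite -[LHS]mulr1 -{2}[1 in LHS]starK -starM mulr1 starK. Qed.

Lemma starX x n : star (x ^+ n) = star x ^+ n.
Proof.
by elim: n => [|n IHn]; rewrite ?expr0 ?star1 // exprS starM IHn -exprSr.
Qed.

Lemma cnorm1_le1 : cnorm (1 : A) <= 1.
Proof.
have := cnorm_star (1 : A); rewrite star1 mulr1.
have := cnorm_ge0 (1 : A); set u := cnorm 1 => u0 uE; nra.
Qed.

Lemma cnorm_real_scalar t : 0 <= t -> cnorm (t%:C *: (1 : A)) <= t.
Proof.
by move=> t0; rewrite cnormZr ger0_norm // ler_piMr // cnorm1_le1.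
Qed.

Lemma cnorm_starE x : cnorm (star x) = cnorm x.
Proof.
have le y : cnorm y <= cnorm (star y).
  have := cnorm_ge0 y; rewrite le_eqVlt => /predU1P[<-|y0].
    exact: cnorm_ge0.
  by rewrite -(ler_pM2r y0) -expr2 -cnorm_star cnormM.
by apply/eqP; rewrite eq_le le -{2}[x]starK le.
Qed.

Lemma cnorm_sqr_sa x : star x = x -> cnorm (x ^+ 2) = cnorm x ^+ 2.
Proof. by move=> sx; rewrite -cnorm_star sx. Qed.

(** Repeated squaring with the C*-identity. It turns bounds on powers of a selfadjoint element into
    bounds on its norm. *)
Lemma cnormX2n_sa x k :
  star x = x -> cnorm (x ^+ (2 ^ k)) = cnorm x ^+ (2 ^ k).
Proof.
move=> sx; elim: k => [|k IHk]; first by rewrite !expr1.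
by rewrite expnS mulnC !exprM cnorm_sqr_sa ?IHk // starX sx.
Qed.

Lemma cnorm_eq0_eps {x} {C : R} :
  (forall e, 0 < e -> cnorm x <= C * e) -> x = 0.
Proof.
move=> xe; apply: cnorm0_eq0; apply/eqP; rewrite eq_le cnorm_ge0 andbT.
apply/ler_addgt0Pr => e e0; rewrite add0r.
have C0 : 0 < `|C| + 1 by rewrite ltr_wpDl.
apply: le_trans (xe _ (divr_gt0 e0 C0)) _.
rewrite mulrCA ger_pMr // ler_pdivrMr // mul1r.
by rewrite (le_trans (ler_norm C)) // lerDl.
Qed.

(* [x + 'i y] has norm [cnorm (x ^+ 2 + y ^+ 2)] squared and real part [x] *)
Lemma cnorm_sqr_le_add x y : star x = x -> star y = y -> x * y = y * x ->
  cnorm x ^+ 2 <= cnorm (x ^+ 2 + y ^+ 2).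
Proof.
move=> sx sy xy; pose w := x + 'i *: y.
have sw : star w = x - 'i *: y.
  by rewrite /w starD sx starZ sy conjCi scaleNr.
have -> : x ^+ 2 + y ^+ 2 = star w * w.
  rewrite sw /w mulrBl !mulrDr -!scalerAl -!scalerAr xy.
  rewrite scalerA -(expr2 'i) sqrCi.
  by rewrite scaleN1r opprD opprK -!expr2 addrA addrK.
rewrite cnorm_star ler_pXn2r ?nnegrE ?cnorm_ge0 //.
have : cnorm (2%:C *: x) <= cnorm w + cnorm (star w).
  suff -> : 2%:C *: x = w + star w by exact: cnormD.
  by rewrite sw /w addrACA subrr addr0 rmorphMn scaler_nat.
rewrite cnormZr cnorm_starE ger0_norm // -mulr2n -[X in _ <= X]mulr_natl.
by rewrite ler_pM2l.
Qed.

End PreCStar.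

(** * Completeness in terms of sequences *)

Section Limits.
Context {R : realType} {A : cstarAlgType R}.
Implicit Types (x y z : A) (t : R).

Definition cnorm_cvg (y : nat -> A) (l : A) : Prop :=
  forall e : R, 0 < e -> exists N, forall n, (N <= n)%N -> cnorm (y n - l) < e.

Lemma cnorm_cauchy_cvg (y : nat -> A) :
  (forall e : R, 0 < e -> exists N, forall m n, (N <= m)%N -> (N <= n)%N ->
    cnorm (y m - y n) < e) ->
  exists l, cnorm_cvg y l.
Proof.
move=> yC; pose u : nat -> normed_space R A := y.
have uC : cauchy (u @ \oo).
  apply/cauchy_ballP => e e0.
  have eE : e = (complex.Re e)%:C by rewrite RRe_real // gtr0_real.
  have [N NP] := yC (complex.Re e) (ltac:(by rewrite -ltcR -eE)).
  have uN : (u @ \oo) [set u n | n in [set n | (N <= n)%N]].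
    by exists N => // n /= Nn; exists n.
  exists ([set u n | n in [set n | (N <= n)%N]],
          [set u n | n in [set n | (N <= n)%N]]) => //=.
  case=> _ _ /= [[m /= Nm <-] [n /= Nn <-]].
  by rewrite -ball_normE /= normed_spaceE eE ltcR; exact: NP.
have ul : u @ \oo --> lim (u @ \oo) by exact: cnorm_complete.
set l := lim _ in ul.
exists l => e e0.
have := iffLR (cvgrPdist_lt _ _) ul e%:C; rewrite ltcR => /(_ _ e0)[N _ NP].
exists N => n Nn; have := NP n Nn.
by rewrite normed_spaceE ltcR cnorm_distC.
Qed.

(** Method of majorants: [eta] is nondecreasing and bounded, so its distance to its supremum
    controls the tails of [y]. *)
Lemma dominated_increments_cvg {y : nat -> A} {eta : nat -> R} {B : R} :
  (forall n, cnorm (y n.+1 - y n) <= eta n.+1 - eta n) ->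
  (forall n, eta n <= B) ->
  exists l, cnorm_cvg y l.
Proof.
move=> yeta etaB.
have dist m d : cnorm (y (m + d)%N - y m) <= eta (m + d)%N - eta m.
  elim: d => [|d IHd]; first by rewrite addn0 !subrr cnorm0.
  rewrite addnS -(subrKA (y (m + d)%N)) -(subrKA (eta (m + d)%N)).
  exact: le_trans (cnormD _ _) (lerD _ _).
have eta_sup : has_sup (range eta).
  by split; [exists (eta 0%N); exists 0%N | exists B => _ [n _ <-]].
apply: cnorm_cauchy_cvg => e e0.
have [_ [N _ <-] etaN] := sup_adherent e0 eta_sup.
exists N => m n Nm Nn; wlog mn : m n Nm Nn / (m <= n)%N => [hw|].
  by case: (leqP m n) => [/hw|/ltnW /hw]; rewrite 1?cnorm_distC; apply.
rewrite cnorm_distC -(subnKC mn); apply: le_lt_trans (dist _ _) _.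
have := ub_le_sup eta_sup.2 (ex_intro2 _ _ (m + (n - m))%N I erefl).
have := dist N (m - N)%N; have := cnorm_ge0 (y (N + (m - N))%N - y N).
rewrite (subnKC Nm) /=; lra.
Qed.

(** Carries closed conditions such as selfadjointness and commutation over to limits: [T l] differs
    from [T (y N) = 0] by at most [C * cnorm (y N - l)]. *)
Lemma cnorm_cvg_eq0 {y : nat -> A} {l : A} (T : A -> A) (C : R) :
  cnorm_cvg y l -> (forall x x', T (x - x') = T x - T x') ->
  (forall x, cnorm (T x) <= C * cnorm x) -> (forall n, T (y n) = 0) -> T l = 0.
Proof.
move=> yl TB TC Ty.
apply: (@cnorm_eq0_eps _ _ _ `|C|) => e /yl[N /(_ N (leqnn N))/ltW yN].
rewrite -cnormN -sub0r -(Ty N) -TB (le_trans (TC _)) //.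
by rewrite (le_trans (ler_wpM2r (cnorm_ge0 _) (ler_norm _))) // ler_wpM2l.
Qed.

Lemma cnorm_cvg_comm {y : nat -> A} {l : A} z :
  cnorm_cvg y l -> (forall n, z * y n = y n * z) -> z * l = l * z.
Proof.
move=> yl zy; apply/eqP; rewrite -subr_eq0; apply/eqP.
apply: (cnorm_cvg_eq0 (fun x => z * x - x * z) (2 * cnorm z) yl)
  => [x x'|x|n]; last by rewrite zy subrr.
- rewrite mulrBl mulrBr !opprB addrACA [RHS]addrACA; congr (_ + _).
  exact: addrC.
- apply: le_trans (cnormB _ _) _.
  by rewrite -mulrA mulr_natl mulr2n lerD ?cnormM // mulrC cnormM.
Qed.

End Limits.

(** * Square roots by iteration *)

Section SquareRoot.
Context {R : realType} {A : cstarAlgType R}.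
Implicit Types (x y z k : A) (t : R).

(* The root of [1 - k] is [1 - y], where [y] is a fixed point of
   [y |-> (k + y ^+ 2) / 2]; the iterates are dominated by those of the scalar
   map with [k = 1]. *)
Lemma root_one_sub k : star k = k -> cnorm k <= 1 ->
  exists y, [/\ star y = y, cnorm y <= 1, (1 - y) ^+ 2 = 1 - k &
    forall z, z * k = k * z -> z * y = y * z].
Proof.
move=> sk k1.
pose y := fix y n : A := if n is n'.+1 then (2^-1)%:C *: (k + y n' ^+ 2) else 0.
pose eta := fix eta n : R := if n is n'.+1 then 2^-1 * (1 + eta n' ^+ 2) else 0.
have eta_bd n : 0 <= eta n <= 1 by elim: n => [|n IHn] /=; [lra | nra].
have y_eta n : cnorm (y n) <= eta n.
  elim: n => [|n IHn] /=; first by rewrite cnorm0.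
  rewrite cnormZr ger0_norm ?invr_ge0 // ler_pM2l ?invr_gt0 //.
  apply: le_trans (cnormD _ _) (lerD k1 _).
  apply: le_trans (cnormM _ _) _.
  by rewrite expr2 ler_pM ?cnorm_ge0.
have half2 : (2^-1)%:C + (2^-1)%:C = 1 :> R[i].
  by rewrite -rmorphD; apply: (congr1 (real_complex R)); lra.
have dist n : cnorm (y n.+1 - y n) <= eta n.+1 - eta n.
  elim: n => [|n IHn].
    rewrite /= !expr0n /= !addr0 !subr0 mulr1 cnormZr ger0_norm ?invr_ge0 //.
    by rewrite ler_piMr ?invr_ge0.
  (* The difference of two squares, expanded in a form valid without commutativity; its scalar
     counterpart is [(eta n.+1 + eta n) * (eta n.+1 - eta n)]. *)
  have -> : y n.+2 - y n.+1 = (2^-1)%:C *: (y n.+1 * (y n.+1 - y n)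
                                          + (y n.+1 - y n) * y n).
    rewrite [y n.+2]/= [in X in _ - X]/= -scalerBr; congr (_ *: _).
    rewrite -/(y n.+1) opprD addrACA subrr add0r mulrBr mulrBl addrA.
    by rewrite subrK.
  rewrite cnormZr ger0_norm ?invr_ge0 //.
  have S_le : cnorm (y n.+1 * (y n.+1 - y n) + (y n.+1 - y n) * y n)
      <= (eta n.+1 + eta n) * (eta n.+1 - eta n).
    apply: le_trans (cnormD _ _) _.
    rewrite [X in _ <= X]mulrDl [X in _ <= _ + X]mulrC.
    by apply: lerD; apply: le_trans (cnormM _ _) _; rewrite ler_pM ?cnorm_ge0.
  rewrite -(ler_pM2l (x := 2^-1)) ?invr_gt0 // in S_le.
  apply: le_trans S_le _; rewrite [eta n.+2]/= -/(eta n.+1).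
  have -> : eta n.+1 = 2^-1 * (1 + eta n ^+ 2) by [].
  by move: (eta n) => u; lra.
have [l yl] := dominated_increments_cvg dist (fun n => (andP (eta_bd n)).2).
have l1 : cnorm l <= 1.
  apply/ler_addgt0Pr => e /yl[N /(_ N (leqnn N))/ltW yN].
  rewrite -[l](subKr (y N)); apply: le_trans (cnormB _ _) (lerD _ _) => //.
  by apply: le_trans (y_eta N) _; case/andP: (eta_bd N).
have lE : l - (2^-1)%:C *: (k + l ^+ 2) = 0.
  (* Replacing [l] by iterates costs [e] for [y N.+1] and half of [2 * e] for the squares. *)
  apply: (@cnorm_eq0_eps _ _ _ 2) => e /yl[N yN].
  have -> : l - (2^-1)%:C *: (k + l ^+ 2) = (l - y N.+1)
      + (2^-1)%:C *: (y N * (y N - l) + (y N - l) * l).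
    rewrite -[y N.+1]/((2^-1)%:C *: (k + y N ^+ 2)) mulrBr mulrBl addrA subrK.
    rewrite -[LHS](subrKA ((2^-1)%:C *: (k + y N ^+ 2))) -scalerBr.
    by rewrite opprD addrACA subrr add0r.
  apply: le_trans (cnormD _ _) _; rewrite cnorm_distC.
  rewrite cnormZr ger0_norm ?invr_ge0 //.
  have S_le : cnorm (y N * (y N - l) + (y N - l) * l) <= 2 * e.
    rewrite mulr_natl mulr2n; apply: le_trans (cnormD _ _) _.
    have [_ etaN1] := andP (eta_bd N).
    have yN1 := le_trans (y_eta N) etaN1.
    apply: lerD; apply: le_trans (cnormM _ _) _.
      by rewrite -[e]mul1r ler_pM ?cnorm_ge0 // ltW ?yN.
    by rewrite -[e]mulr1 ler_pM ?cnorm_ge0 // ltW ?yN.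
  have := yN N.+1 (leqnSn N); lra.
exists l; split=> //.
- apply/eqP; rewrite -subr_eq0; apply/eqP.
  apply: (cnorm_cvg_eq0 (fun x => star x - x) 2 yl) => [x x'|x|n].
  + by rewrite starB !opprB addrACA [RHS]addrACA; congr (_ + _); exact: addrC.
  + by rewrite (le_trans (cnormB _ _)) // cnorm_starE mulr_natl mulr2n.
  + apply/eqP; rewrite subr_eq0; apply/eqP.
    by elim: n => [|n IHn] /=; rewrite ?star0 // starZr starD sk starX IHn.
- move/eqP: lE; rewrite subr_eq0 => /eqP lE.
  rewrite expr2 mulrBl mul1r mulrBr mulr1 opprB addrA addrAC -expr2.
  have -> : 1 - l - l = 1 - (k + l ^+ 2).
    by rewrite -addrA -opprD {1 2}lE -scalerDl half2 scale1r.
  by rewrite opprD addrA subrK.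
- move=> z zk; apply: (cnorm_cvg_comm _ yl).
  elim=> [|n IHn] /=; first by rewrite mulr0 mul0r.
  rewrite -scalerAr -scalerAl mulrDr mulrDl zk; congr (_ *: (_ + _)).
  exact: commrX.
Qed.

End SquareRoot.

(** * The positive cone and the positivity of [star a * a] *)

Section PositiveCone.
Context {R : realType} {A : cstarAlgType R}.
Implicit Types (a b c h k q x y z : A) (t : R).

(* Selfadjoint elements whose distance to some [t > 0] is at most [t]: a
   spectrum-free description of the positive elements. *)
Definition poscone h : Prop :=
  star h = h /\ exists2 t : R, 0 < t & cnorm (t%:C *: 1 - h) <= t.

Lemma posconeD h k : poscone h -> poscone k -> poscone (h + k).
Proof.
case=> sh [t t0 ht] [sk [u u0 ku]]; split; first by rewrite starD sh sk.
exists (t + u); first exact: addr_gt0.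
rewrite rmorphD scalerDl opprD addrACA.
exact: le_trans (cnormD _ _) (lerD _ _).
Qed.

Lemma posconeZ t h : 0 < t -> poscone h -> poscone (t%:C *: h).
Proof.
move=> t0 [sh [u u0 hu]]; split; first by rewrite starZr sh.
exists (t * u); first exact: mulr_gt0.
by rewrite rmorphM -scalerA -scalerBr cnormZr gtr0_norm // ler_pM2l.
Qed.

(** Dividing by [t] reduces to [root_one_sub]. The root [Num.sqrt t] times [1 - y] is in the cone,
    with centre [Num.sqrt t], because [cnorm y <= 1]. *)
Lemma root_real_sub t k : 0 < t -> star k = k -> cnorm k <= t ->
  exists s, [/\ poscone s, s ^+ 2 = t%:C *: 1 - k &
    forall z, z * k = k * z -> z * s = s * z].
Proof.
move=> t0 sk kt; pose k' := (t^-1)%:C *: k.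
have sk' : star k' = k' by rewrite starZr sk.
have k'1 : cnorm k' <= 1.
  by rewrite cnormZr gtr0_norm ?invr_gt0 // mulrC ler_pdivrMr ?mul1r.
have [y [sy y1 yE yC]] := root_one_sub k' sk' k'1.
have r0 : 0 < Num.sqrt t by rewrite sqrtr_gt0.
exists ((Num.sqrt t)%:C *: (1 - y)); split.
- split; first by rewrite starZr starB star1 sy.
  exists (Num.sqrt t) => //.
  by rewrite -scalerBr opprB addrC subrK cnormZr gtr0_norm // ler_piMr // ltW.
- rewrite exprZn yE -rmorphXn sqr_sqrtr ?ltW // scalerBr; congr (_ - _).
  by rewrite /k' scalerA -rmorphM divff ?gt_eqF // scale1r.
move=> z zk; have zy : z * y = y * z.
  by apply: yC; rewrite /k' -scalerAr -scalerAl zk.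
by rewrite -scalerAr -scalerAl mulrBr mulrBl mulr1 mul1r zy.
Qed.

Lemma poscone_root h : poscone h ->
  exists s, [/\ poscone s, s ^+ 2 = h &
    forall z, z * h = h * z -> z * s = s * z].
Proof.
case=> sh [t t0 ht].
have skt : star (t%:C *: 1 - h) = t%:C *: 1 - h.
  by rewrite starB starZr star1 sh.
have [s [ps sE sC]] := root_real_sub t _ t0 skt ht.
exists s; split=> // [|z zh]; first by rewrite sE opprB addrC subrK.
by apply: sC; rewrite mulrBr mulrBl -scalerAr -scalerAl mulr1 mul1r zh.
Qed.

(** For large [t], [t - h ^+ 2] is the square of some [s] commuting with [h], and [cnorm (s ^+ 2) <=
    cnorm (s ^+ 2 + h ^+ 2) = cnorm t <= t]. *)
Lemma poscone_sqr h : star h = h -> poscone (h ^+ 2).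
Proof.
move=> sh; pose t := cnorm (h ^+ 2) + 1.
have t0 : 0 < t by rewrite ltr_wpDl ?cnorm_ge0.
have sh2 : star (h ^+ 2) = h ^+ 2 by rewrite starX sh.
have h2t : cnorm (h ^+ 2) <= t by rewrite lerDl.
have [s [[ss _] sE sC]] := root_real_sub t _ t0 sh2 h2t.
split=> //; exists t => //; rewrite -sE cnorm_sqr_sa //.
apply: le_trans (cnorm_sqr_le_add s h ss sh _) _.
  by apply/esym/sC; rewrite -exprS -exprSr.
by rewrite sE subrK cnorm_real_scalar // ltW.
Qed.

(** The roots [r] of [q] and [s] of [- q] commute, so [cnorm r ^+ 2] is at most the norm of
    [r ^+ 2 + s ^+ 2 = 0]. *)
Lemma poscone_anti q : poscone q -> poscone (- q) -> q = 0.
Proof.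
move=> /poscone_root[r [[sr _] rE rC]] /poscone_root[s [[ss _] sE sC]].
have rs : r * s = s * r.
  by apply: sC; rewrite mulrN mulNr -rE -exprS -exprSr.
have := cnorm_sqr_le_add r s sr ss rs.
rewrite rE sE subrr cnorm0 => r0.
rewrite -rE (cnorm0_eq0 r _) ?expr0n //.
by apply/eqP; rewrite -sqrf_eq0 eq_le r0 sqr_ge0.
Qed.

(* [w ^+ n.+1 - w ^+ n = c * u ^+ n * star c] stays bounded, so the powers of
   the selfadjoint [w] grow at most linearly. *)
Lemma star_mul_contraction_eq0 c :
  poscone (c * star c) -> cnorm (1 + star c * c) <= 1 -> c = 0.
Proof.
move=> pq u1; set u := 1 + star c * c in u1.
pose w := 1 + c * star c; pose M := cnorm c * cnorm (star c).
have M0 : 0 <= M by rewrite mulr_ge0 ?cnorm_ge0.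
have sw : star w = w by rewrite starD star1 pq.1.
have un n : cnorm (u ^+ n) <= 1.
  elim: n => [|n IHn]; first by rewrite expr0 cnorm1_le1.
  by rewrite exprS (le_trans (cnormM _ _)) // mulr_ile1 ?cnorm_ge0.
have uw n : u ^+ n * star c = star c * w ^+ n.
  elim: n => [|n IHn]; first by rewrite !expr0 mulr1 mul1r.
  rewrite exprS -mulrA IHn mulrA exprS [RHS]mulrA; congr (_ * _).
  by rewrite mulrDl mulrDr mul1r mulr1 mulrA.
have wS n : w ^+ n.+1 = w ^+ n + c * u ^+ n * star c.
  by rewrite -mulrA uw mulrA exprS {1}/w mulrDl mul1r.
have wn n : cnorm (w ^+ n) <= 1 + n%:R * M.
  elim: n => [|n IHn]; first by rewrite expr0 mul0r addr0 cnorm1_le1.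
  rewrite wS -natr1 mulrDl mul1r addrA.
  apply: le_trans (cnormD _ _) (lerD IHn _).
  apply: le_trans (cnormM _ _) _; rewrite ler_wpM2r ?cnorm_ge0 //.
  by apply: le_trans (cnormM _ _) _; rewrite ler_piMr ?cnorm_ge0.
have w1 : cnorm w <= 1.
  rewrite leNgt; apply/negP => w1.
  pose d := cnorm w - 1; have d0 : 0 < d by rewrite subr_gt0.
  have bernoulli m : 1 + m%:R * d <= cnorm w ^+ m.
    elim: m => [|m IHm]; first by rewrite mul0r addr0 expr0.
    have wE : cnorm w = 1 + d by rewrite addrC subrK.
    rewrite exprS -natr1; move: IHm; rewrite wE => IHm.
    have m0 : 0 <= m%:R :> R by [].
    have : 0 <= m%:R * d ^+ 2 by rewrite mulr_ge0 ?sqr_ge0.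
    rewrite expr2; nra.
  (* With [m = 2 ^ j], compare [(1 + m * d) ^+ 2 <= cnorm w ^+ (2 * m) <= 1 + 2 * m * M]; at powers
     of two the norm commutes with the power. *)
  have pow_le (j : nat) : (2 ^ j)%:R * d ^+ 2 <= 2 * M.
    have m0 : 0 < (2 ^ j)%:R :> R by rewrite ltr0n expn_gt0.
    have := wn (2 ^ j.+1)%N; rewrite cnormX2n_sa // expnSr natrM exprM.
    have := bernoulli (2 ^ j)%N; move: (cnorm w ^+ _) m0 => p.
    move: (2 ^ j)%:R => m m0 mp pM; rewrite -(ler_pM2l m0).
    have md0 : 0 <= m * d by rewrite mulr_ge0 ?ltW.
    have : (1 + m * d) ^+ 2 <= p ^+ 2.
      by rewrite ler_pXn2r ?nnegrE ?addr_ge0 // (le_trans _ mp) ?addr_ge0.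
    move: pM md0; rewrite !expr2 => pM md0 mdp. nra.
  have [j jE] : exists j : nat, 2 * M / d ^+ 2 < j%:R.
    exists (Num.bound (2 * M / d ^+ 2)); apply: archi_boundP.
    apply: divr_ge0; [exact: mulr_ge0 | exact: sqr_ge0].
  have := pow_le j; apply/negP; rewrite -ltNge -ltr_pdivrMr ?exprn_gt0 //.
  by apply: lt_trans jE _; rewrite ltr_nat ltn_expl.
(* [cnorm w <= 1] says that [- (c * star c)] is in the cone, with [t = 1]. *)
have q0 : c * star c = 0.
  apply: poscone_anti => //; split; first by rewrite starN pq.1.
  by exists 1; rewrite // scale1r opprK.
have := cnorm_star (star c); rewrite starK q0 cnorm0 cnorm_starE => /esym/eqP.
by rewrite sqrf_eq0 => /eqP /cnorm0_eq0.
Qed.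

(** [c * star c + star c * c] is half a sum of two selfadjoint squares, so [c * star c] is in the
    cone too; a multiple of [c] then satisfies [star_mul_contraction_eq0]. *)
Lemma poscone_oppr_star_mul c : poscone (- (star c * c)) -> c = 0.
Proof.
move=> pc; have [_ [t t0 ct]] := pc.
have pq : poscone (c * star c).
  pose x := c + star c; pose y := 'i *: (c - star c).
  have sx : star x = x by rewrite starD starK addrC.
  have sy : star y = y.
    by rewrite starZ starB starK conjCi scaleNr -scalerN opprB.
  have xy : x ^+ 2 + y ^+ 2 = 2%:C *: (c * star c + star c * c).
    have xE : x ^+ 2 = (c * c + star c * star c) + (c * star c + star c * c).
      by rewrite expr2 mulrDl !mulrDr (addrC (star c * c)) addrACA.
    have yE : (c - star c) ^+ 2
        = (c * c + star c * star c) - (c * star c + star c * c).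
      by rewrite expr2 mulrBl !mulrBr opprB addrACA opprD.
    rewrite exprZn sqrCi scaleN1r xE yE opprD opprK addrACA subrr add0r -mulr2n.
    by rewrite rmorphMn scaler_nat.
  have -> : c * star c = (2^-1)%:C *: (x ^+ 2 + y ^+ 2) + - (star c * c).
    by rewrite xy scalerA -rmorphM mulVf ?scale1r ?addrK.
  apply: posconeD => //; apply: posconeZ => //.
  by apply: posconeD; exact: poscone_sqr.
(* Since [l ^+ 2 = t^-1], replacing [c] by [l%:C *: c] turns [1 + star c * c] into [t^-1] times
   [t + star c * c], of norm at most 1. *)
pose l := Num.sqrt t^-1; have l0 : 0 < l by rewrite sqrtr_gt0 invr_gt0.
have ll : l%:C * l%:C = (t^-1)%:C.
  by rewrite -rmorphM -expr2 sqr_sqrtr // invr_ge0 ltW.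
have t0' : 0 < t^-1 by rewrite invr_gt0.
have : l%:C *: c = 0.
  apply: star_mul_contraction_eq0;
    rewrite starZr -scalerAl -scalerAr scalerA ll.
    exact: posconeZ.
  have -> : 1 + (t^-1)%:C *: (star c * c)
      = (t^-1)%:C *: (t%:C *: 1 - - (star c * c)).
    by rewrite opprK scalerDr scalerA -rmorphM mulVf ?gt_eqF // scale1r.
  by rewrite cnormZr gtr0_norm // mulrC ler_pdivrMr // mul1r.
move/eqP; rewrite scaler_eq0 => /orP[|/eqP //].
by rewrite (inj_eq (@complexI R) l 0) gt_eqF.
Qed.

(* With [m = |b|], [n = m - b] is twice the negative part of [b], so
   [star (a * n) * (a * n) = n * b * n = - n * m * n] is minus a square. *)
Lemma poscone_star_mul a : poscone (star a * a).
Proof.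
set b := star a * a.
have sb : star b = b by rewrite starM starK.
have [m [pm mE mC]] := poscone_root _ (poscone_sqr _ sb).
have bm : b * m = m * b by apply: mC; rewrite -exprS -exprSr.
have [r [[sr _] rE rC]] := poscone_root _ pm.
pose n := m - b; have sn : star n = n by rewrite starB pm.1 sb.
have nm : n * m = m * n by rewrite mulrBl mulrBr bm.
have nb : n * b = - (m * n).
  by rewrite mulrBl mulrBr -bm -!expr2 mE opprB.
have nr : n * r = r * n by apply: rC.
have d2 : (n * r) ^+ 2 = n * m * n.
  by rewrite expr2 {2}nr -mulrA (mulrA r) -expr2 rE mulrA.
have nbn : star (a * n) * (a * n) = - (n * r) ^+ 2.
  by rewrite starM sn !mulrA -(mulrA n) -/b nb d2 mulNr nm.
have an0 : a * n = 0.
  apply: poscone_oppr_star_mul; rewrite nbn opprK; apply: poscone_sqr.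
  by rewrite starM sn sr nr.
have nmn0 : n * m * n = 0.
  by rewrite -d2; apply/eqP; rewrite -oppr_eq0 -nbn an0 mulr0.
have n3 : n * n * n = 0.
  have -> : n * n * n = n * m * n - n * b * n by rewrite -mulrBl -mulrBr.
  by rewrite nb mulNr opprK -nm nmn0 addr0.
(* The exponent is raised to a power of two so that [cnormX2n_sa] applies. *)
have n4 : n ^+ (2 ^ 2) = 0.
  by rewrite -[(2 ^ 2)%N]/4%N !exprS expr0 mulr1 !mulrA n3 mul0r.
have n0 : n = 0.
  have := cnormX2n_sa n 2 sn; rewrite n4 cnorm0 => /esym/eqP.
  by rewrite expf_eq0 => /andP[_ /eqP/cnorm0_eq0].
by move/eqP: n0; rewrite subr_eq0 => /eqP <-.
Qed.

End PositiveCone.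

(** * Invertibility, spectrum and absolute value *)

Section Spectrum.
Context {R : realType} {A : cstarAlgType R}.
Implicit Types (a b h x y : A) (t : R) (l z : R[i]).

(** Neumann series: [y n] sums the first [n] powers of [x], and [eta n] those of [q]. *)
Lemma invertible_sub1 x : cnorm x < 1 -> invertible (1 - x).
Proof.
move=> x1; set q := cnorm x in x1; have q0 : 0 <= q := cnorm_ge0 x.
pose y := fix y n : A := if n is n'.+1 then 1 + x * y n' else 0.
pose eta := fix eta n : R := if n is n'.+1 then 1 + q * eta n' else 0.
have yS n : y n.+1 = 1 + x * y n by [].
have etaS n : eta n.+1 = 1 + q * eta n by [].
have dist n : cnorm (y n.+1 - y n) <= eta n.+1 - eta n.
  elim: n => [|n IHn]; first by rewrite /= !mulr0 !addr0 !subr0 cnorm1_le1.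
  have -> : y n.+2 - y n.+1 = x * (y n.+1 - y n).
    rewrite (yS n.+1) [in X in _ - X](yS n) opprD addrACA subrr add0r.
    by rewrite -mulrBr.
  have -> : eta n.+2 - eta n.+1 = q * (eta n.+1 - eta n).
    rewrite (etaS n.+1) [in X in _ - X](etaS n) opprD addrACA subrr add0r.
    by rewrite -mulrBr.
  by apply: le_trans (cnormM _ _) _; rewrite ler_wpM2l.
have eta_bd n : eta n <= (1 - q)^-1.
  have q1 : 0 < 1 - q by rewrite subr_gt0.
  rewrite -[_^-1]mul1r ler_pdivlMr //.
  by elim: n => [|n IHn] /=; [rewrite mul0r | nra].
have [l yl] := dominated_increments_cvg dist eta_bd.
have lE : l = 1 + x * l.
  apply/eqP; rewrite -subr_eq0; apply/eqP.
  apply: (@cnorm_eq0_eps _ _ _ 2) => e /yl[N yN].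
  have -> : l - (1 + x * l) = (l - y N.+1) + x * (y N - l).
    by rewrite yS mulrBr addrA [in LHS]opprD [in RHS]opprD !addrA subrK.
  apply: le_trans (cnormD _ _) _; rewrite cnorm_distC.
  have := cnormM x (y N - l); rewrite -/q.
  have := yN N (leqnn N); have := yN N.+1 (leqnSn N).
  have := cnorm_ge0 (y N - l); nra.
have xl : x * l = l * x.
  apply: (cnorm_cvg_comm _ yl).
  elim=> [|n IHn] /=; first by rewrite mulr0 mul0r.
  by rewrite mulrDr mulrDl mulr1 mul1r -mulrA -IHn.
by exists l; rewrite mulrBl mulrBr mul1r mulr1 -xl {1 3}lE addrK.
Qed.

Lemma invertibleZ z x : z != 0 -> invertible x -> invertible (z *: x).
Proof.
move=> z0 [y [xy yx]]; exists (z^-1 *: y).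
by rewrite -!scalerAl -!scalerAr !scalerA xy yx divff ?mulVf // scale1r.
Qed.

(** Factoring out [z - l] leaves [1] minus an element of norm below 1. *)
Lemma invertible_sub_scalar l z h :
  cnorm (z *: 1 - h) < complex.Re `|z - l| -> invertible (h - l *: 1).
Proof.
move=> hz; have d0 : z - l != 0.
  apply/eqP => d0; move: hz; rewrite d0 normr0 /= ltNge.
  by rewrite cnorm_ge0.
have dR : (complex.Re `|z - l|)%:C = `|z - l| by rewrite RRe_real.
have d_gt0 : 0 < complex.Re `|z - l| by rewrite -ltcR dR normr_gt0.
have -> : h - l *: 1 = (z - l) *: (1 - (z - l)^-1 *: (z *: 1 - h)).
  rewrite scalerBr [in RHS]scalerA divff // scale1r scalerBl opprB.
  by rewrite [RHS]addrC addrA subrK.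
apply: invertibleZ => //; apply: invertible_sub1.
rewrite cnormZ normfV -dR -fmorphV /= mulrC ltr_pdivrMr // mul1r.
by rewrite -[X in _ < X]/(complex.Re (_%:C)) dR.
Qed.

(** By the C*-identity, as [h + 'i t] times [h - 'i t] is [h ^+ 2 + t ^+ 2]. Letting [t] vary forces
    both spectral points and values of states to be real. *)
Lemma cnorm_sub_imaginary h t : star h = h ->
  cnorm (h - ('i * t%:C) *: 1) ^+ 2 <= cnorm h ^+ 2 + t ^+ 2.
Proof.
move=> sh; rewrite -cnorm_star starB starZ star1 sh rmorphM /=.
rewrite conjCi conjC_real mulNr scaleNr opprK.
have -> : (h + ('i * t%:C) *: 1) * (h - ('i * t%:C) *: 1)
    = h ^+ 2 + (t ^+ 2)%:C *: 1.
  rewrite mulrDl !mulrBr -!scalerAl -!scalerAr mul1r !mulr1 scalerA.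
  rewrite mulrACA -!expr2 sqrCi mulN1r scaleNr opprK addrA subrK.
  by rewrite rmorphXn.
apply: le_trans (cnormD _ _) _; rewrite cnorm_sqr_sa //.
by rewrite lerD2l cnorm_real_scalar // sqr_ge0.
Qed.

Lemma Re_norm_sqr z :
  complex.Re `|z| ^+ 2 = complex.Re z ^+ 2 + complex.Im z ^+ 2.
Proof. by rewrite normc_def /= sqr_sqrtr // addr_ge0 ?sqr_ge0. Qed.

Lemma Re_norm_ge0 z : 0 <= complex.Re `|z|.
Proof. by rewrite normc_def sqrtr_ge0. Qed.

Lemma sqr_sub_le_eq0 (be K : R) :
  (forall mu : R, (be - mu) ^+ 2 <= K + mu ^+ 2) -> be = 0.
Proof.
move=> leK; apply/eqP/negPn/negP => be0.
have b2 : 0 < be ^+ 2 by rewrite exprn_even_gt0.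
(* At [mu = - (s * be)] the terms [mu ^+ 2] cancel, leaving [be ^+ 2 + 2 * s * be ^+ 2 <= K]; [s]
   makes the second summand [K]. *)
pose s := K / (2 * be ^+ 2); have := leK (- (s * be)).
have : 2 * s * be ^+ 2 = K by rewrite /s; field; rewrite be0.
nra.
Qed.

Lemma poscone_positive h : poscone h -> positive h.
Proof.
case=> sh [t t0 ht]; split=> // l nl.
(* Spectral points lie in every disc that contains [h]: the discs centred at
   [Re l + 'i * mu] exclude nonreal [l], the one at [t] excludes [l < 0]. *)
have lC z : complex.Re `|z - l| <= cnorm (z *: 1 - h).
  by rewrite leNgt; apply/negP => /invertible_sub_scalar.
case: l nl lC => al be _ lC.
suff be0 : be = 0.
  subst be; rewrite lecE /= eqxx /=.
  have := lC t%:C; rewrite normc_def /= oppr0 addr0 (expr0n _ 2) addr0.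
  rewrite sqrtr_sqr => /le_trans/(_ ht); have := ler_norm (t - al); lra.
have sa : star (h - al%:C *: 1) = h - al%:C *: 1.
  by rewrite starB starZr star1 sh.
apply: (@sqr_sub_le_eq0 _ (cnorm (h - al%:C *: 1) ^+ 2)) => mu.
apply: le_trans (cnorm_sub_imaginary _ mu sa).
have := lC (al%:C + 'i * mu%:C).
rewrite cnorm_distC scalerDl opprD addrA => le1.
apply: (@le_trans _ _ (complex.Re `|al%:C + 'i * mu%:C - (al +i* be)| ^+ 2));
  last by rewrite ler_pXn2r ?nnegrE ?Re_norm_ge0 ?cnorm_ge0.
rewrite Re_norm_sqr -complexiE le_eqVlt; apply/orP; left; apply/eqP => /=; ring.
Qed.

(** The choice made by [xget] satisfies its defining property once one positive root is
    exhibited. *)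
Lemma absA_sqr a : absA a ^+ 2 = star a * a.
Proof.
have [s [/poscone_positive ps sE _]] := poscone_root _ (poscone_star_mul a).
pose S := [set b : A | positive b /\ b ^+ 2 = star a * a].
by case: (xgetPex 0 (ex_intro S s (conj ps sE))).
Qed.

End Spectrum.

(** * Inequalities for states *)

Section States.
Context {R : realType} {A : cstarAlgType R}.
Context {f : {linear A -> (R[i])^o}}.
Hypothesis f_state : states f.
Implicit Types (a b h x y : A) (t : R).

Lemma state1 : f 1 = 1.
Proof. by case: f_state. Qed.

Lemma linear_scalarZ (k : R[i]) x : f (k *: x) = k * (f x : R[i]) :> R[i].
Proof. exact: linearZ. Qed.

Lemma linear_scalarB x y : f (x - y) = (f x : R[i]) - (f y : R[i]) :> R[i].
Proof. exact: linearB. Qed.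

Lemma state_le_cnorm x : complex.Re `|f x : R[i]| <= cnorm x.
Proof.
have [->|x0] := eqVneq x 0; first by rewrite linear0 normr0 cnorm0.
have nx : 0 < cnorm x.
  rewrite lt_def cnorm_ge0 andbT.
  by apply: contra_neq x0; exact: cnorm0_eq0.
pose y := (cnorm x)^-1%:C *: x.
have y1 : cnorm y <= 1.
  by rewrite cnormZr ger0_norm ?invr_ge0 ?cnorm_ge0 // mulVf ?gt_eqF.
have : complex.Re `|f y : R[i]| <= 1.
  case: f_state => _ _ nf; rewrite -lee_fin -nf.
  by apply: ereal_sup_ubound; exists y.
rewrite linear_scalarZ normrM ger0_norm ?ler0c ?invr_ge0 ?cnorm_ge0 //.
rewrite -(RRe_real (normr_real (f x : R[i]))) -rmorphM /=.
by rewrite mulrC ler_pdivrMr // mul1r.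
Qed.

(** [f h - 'i mu] is the value of [f] at [h - 'i mu], so its squared modulus is at most
    [cnorm h ^+ 2 + mu ^+ 2] for every real [mu]. *)
Lemma state_real h : star h = h -> complex.Im (f h) = 0.
Proof.
move=> sh; apply: (@sqr_sub_le_eq0 _ _ (cnorm h ^+ 2)) => mu.
apply: le_trans (cnorm_sub_imaginary _ mu sh).
apply: (@le_trans _ _ (complex.Re `|f (h - ('i * mu%:C) *: 1) : R[i]| ^+ 2));
  last by rewrite ler_pXn2r ?nnegrE ?Re_norm_ge0 ?cnorm_ge0 ?state_le_cnorm.
rewrite Re_norm_sqr linear_scalarB linear_scalarZ state1 mulr1 -complexiE.
case: (f h) => u v /=; nra.
Qed.

(** [f h] is real and at distance at most [t] from [t]. *)
Lemma state_poscone_ge0 h : poscone h -> 0 <= (f h : R[i]).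
Proof.
case=> sh [t t0 ht]; have := state_real _ sh.
have := le_trans (state_le_cnorm (t%:C *: 1 - h)) ht.
rewrite linear_scalarB linear_scalarZ state1 mulr1 lecE.
case: (f h) => u v /= le1 v0; rewrite v0 eqxx /=.
move: le1; rewrite v0 subr0 expr0n addr0 sqrtr_sqr.
have := ler_norm (t - u); lra.
Qed.

(** [f] is real on the selfadjoint elements [x + star x] and ['i *: (x - star x)]. *)
Lemma state_star x : f (star x) = Num.conj (f x : R[i]) :> R[i].
Proof.
have := @state_real (x + star x); rewrite starD starK addrC => /(_ erefl).
have := @state_real ('i *: (x - star x)).
rewrite starZ starB starK conjCi scaleNr -scalerN opprB => /(_ erefl).
rewrite linear_scalarZ linear_scalarB linearD -complexiE.
case: (f x) (f (star x)) => u v [u' v'] /= H1 H2.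
apply/eqP; rewrite eq_complex /=; apply/andP; split; apply/eqP; lra.
Qed.

Lemma state_star_mul_ge0 x : 0 <= (f (star x * x) : R[i]).
Proof. exact/state_poscone_ge0/poscone_star_mul. Qed.

(* nonnegativity of the variance, [0 <= f (star (a - f a) * (a - f a))] *)
Lemma state_sqr_le a : `|f a : R[i]| ^+ 2 <= (f (star a * a) : R[i]).
Proof.
pose l : R[i] := f a.
have := state_star_mul_ge0 (a - l *: 1).
rewrite starB starZ star1 mulrBl !mulrBr -!scalerAl -!scalerAr mulr1 !mul1r.
rewrite !linear_scalarB !linear_scalarZ state1 mulr1 state_star -/l.
by rewrite (mulrC _ l) subrr subr0 subr_ge0 -normCK.
Qed.

Lemma state_mul_star_sqr_le a : `|f a : R[i]| ^+ 2 <= (f (a * star a) : R[i]).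
Proof.
have := state_sqr_le (star a); rewrite starK state_star.
by rewrite norm_conjC.
Qed.

Lemma state_conj_star_mulX_ge0 a y n :
  0 <= (f (star y * (star a * a) ^+ n * y) : R[i]).
Proof.
set b := star a * a; have sb : star b = b by rewrite starM starK.
(* Two consecutive exponents are carried along, since absorbing one [b] into each copy of [y] lowers
   the exponent by 2. *)
suff: 0 <= (f (star y * b ^+ n * y) : R[i]) /\
      0 <= (f (star y * b ^+ n.+1 * y) : R[i]) by case.
elim: n y => [|n IHn] y.
  rewrite expr0 expr1 mulr1; split; first exact: state_star_mul_ge0.
  by rewrite /b mulrA -mulrA -starM state_star_mul_ge0.
split; first by case: (IHn y).
have -> : star y * b ^+ n.+2 * y = star (b * y) * b ^+ n * (b * y).
  by clearbody b; rewrite starM sb exprS exprSr !mulrA.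
by case: (IHn (b * y)).
Qed.

(* With [g = b - f b], [f (g * b ^+ r)] is nonnegative by induction on [r]. *)
Lemma state_star_mulX_ge a r :
  (f (star a * a) : R[i]) ^+ r <= (f ((star a * a) ^+ r) : R[i]).
Proof.
set b := star a * a; have sb : star b = b by rewrite starM starK.
pose m : R[i] := f b; have m0 : 0 <= m by exact: state_star_mul_ge0.
pose g := b - m *: 1.
have sg : star g = g.
  by rewrite starB starZ star1 sb conj_Creal // ger0_real.
have gb n : 0 <= (f (g * b ^+ n) : R[i]).
  elim: n => [|n IHn].
    by rewrite expr0 mulr1 linear_scalarB linear_scalarZ state1 mulr1 subrr.
  (* The last factor [b] is split as [g + m]: a conjugated power plus a multiple of the previous
     case. *)
  have -> : g * b ^+ n.+1 = star g * b ^+ n * g + m *: (g * b ^+ n).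
    by rewrite sg exprSr mulrA [in RHS]mulrBr -scalerAr mulr1 subrK.
  rewrite linearD linear_scalarZ addr_ge0 ?mulr_ge0 //.
  exact: state_conj_star_mulX_ge0.
elim: r => [|r IHr]; first by rewrite !expr0 state1.
have -> : b ^+ r.+1 = g * b ^+ r + m *: b ^+ r.
  by rewrite mulrBl -scalerAl mul1r subrK exprS.
rewrite linearD linear_scalarZ exprS -[X in X <= _]add0r lerD //.
exact: ler_wpM2l.
Qed.

Lemma state_pow_le a (t : R) r : 0 <= t <= 1 ->
  `|f a : R[i]| ^+ (2 * r) <=
    (f (t%:C *: (star a * a) ^+ r + (1 - t)%:C *: (a * star a) ^+ r) : R[i]).
Proof.
case/andP=> t0 t1.
rewrite linearD !linear_scalarZ exprM.
have le1 : (`|f a : R[i]| ^+ 2) ^+ r <= (f ((star a * a) ^+ r) : R[i]).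
  apply: le_trans (state_star_mulX_ge _ _).
  by rewrite lerXn2r ?nnegrE ?exprn_ge0 ?state_star_mul_ge0 // state_sqr_le.
have le2 : (`|f a : R[i]| ^+ 2) ^+ r <= (f ((a * star a) ^+ r) : R[i]).
  have := state_star_mulX_ge (star a) r; rewrite starK; apply: le_trans.
  rewrite lerXn2r ?nnegrE ?exprn_ge0 ?state_mul_star_sqr_le //.
  by have := state_star_mul_ge0 (star a); rewrite starK.
(* The left side is split with weights [t] and [1 - t], to be bounded by [le1] and [le2]. *)
rewrite -[X in X <= _]mul1r -{1}(subrK t%:C 1) addrC mulrDl.
rewrite -[1 - _](rmorphB _ 1 t).
by rewrite lerD // ler_wpM2l // ler0c ?subr_ge0.
Qed.

End States.

(** * Passage to the numerical radius *)

Lemma numradius_pow_le {R : realType} {A : cstarAlgType R} (a : A) (t : R) r :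
  0 <= t <= 1 -> (0 < r)%N ->
  numradius a ^+ (2 * r) <=
    cnorm (t%:C *: (star a * a) ^+ r + (1 - t)%:C *: (a * star a) ^+ r).
Proof.
move=> t01 r0; set Y := _ + _; have Y0 := cnorm_ge0 Y.
have n0 : (0 < 2 * r)%N by rewrite muln_gt0.
(* Taking the root of the bound first lets the supremum be taken before the power. *)
pose K := cnorm Y `^ (2 * r)%:R^-1.
have KE : K ^+ (2 * r) = cnorm Y.
  by rewrite -powR_mulrn ?powR_ge0 // -powRrM mulVf ?pnatr_eq0 -?lt0n // powRr1.
have K0 : 0 <= K := powR_ge0 _ _.
have le_f f : states f -> complex.Re `|f a| <= K.
  move=> fs; rewrite -(@ler_pXn2r _ (2 * r)) ?nnegrE ?Re_norm_ge0 // KE.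
  apply: le_trans (state_le_cnorm fs Y).
  have le_fY := state_pow_le fs a t r t01.
  have normE x : (complex.Re `|f x|)%:C = `|f x| :> R[i].
    by rewrite RRe_real // normr_real.
  rewrite -lecR normE.
  have -> : (complex.Re `|f a| ^+ (2 * r))%:C = `|f a| ^+ (2 * r) :> R[i].
    by rewrite -normE rmorphXn.
  apply: (le_trans le_fY); apply/real_ler_norm/ger0_real.
  exact: le_trans (exprn_ge0 _ (normr_ge0 _)) le_fY.
(* Without states the supremum is that of the empty set, 0 by convention, and [0 ^+ (2 * r) = 0]
   because [r] is positive. *)
have [[f0 fs0]|no] :=
  pselect (exists f : {linear A -> (R[i])^o}, states f); last first.
  suff -> : numradius a = 0 by rewrite expr0n gtn_eqF.
  rewrite /numradius (_ : image _ _ = set0) ?sup0 //.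
  by rewrite -subset0 => x [f fs _]; apply: no; exists f.
(* Monotonicity of the power asks for [0 <= numradius a], which the state [f0] provides. *)
rewrite -KE lerXn2r ?nnegrE //.
  apply: le_trans (Re_norm_ge0 (f0 a)) _; apply: ub_le_sup; last by exists f0.
  by exists K => _ [f fs <-]; exact: le_f.
apply: ge_sup; first by exists (complex.Re `|f0 a|); exists f0.
by move=> _ [f fs <-]; exact: le_f.
Qed.

Theorem theorem3p5 (R : realType) (A : cstarAlgType R) (a : A) :
  (forall f : {linear A -> (R[i])^o}, states f ->
     forall (t : R) (r : nat), 0 <= t <= 1 -> (0 < r)%N ->
       `|f a| ^+ (2 * r) <=
         f (t%:C *: absA a ^+ (2 * r) + (1 - t)%:C *: absA (star a) ^+ (2 * r))
           :> R[i])
  /\ (forall (t : R) (r : nat), 0 <= t <= 1 -> (0 < r)%N ->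
       numradius a ^+ (2 * r) <=
         cnorm (t%:C *: absA a ^+ (2 * r)
                + (1 - t)%:C *: absA (star a) ^+ (2 * r)))
  /\ (forall t : R, 0 <= t <= 1 ->
       numradius a ^+ 2 <=
         cnorm (t%:C *: (star a * a) + (1 - t)%:C *: (a * star a))).
Proof.
have absX (b : A) r : absA b ^+ (2 * r) = (star b * b) ^+ r.
  by rewrite exprM absA_sqr.
split; [|split].
- by move=> f fs t r t01 r0; rewrite !absX starK; exact: state_pow_le.
- by move=> t r t01 r0; rewrite !absX starK; exact: numradius_pow_le.
- by move=> t t01; have := numradius_pow_le a t 1 t01 isT.
Qed.
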